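(* For every positive integer $m$, \[ B_{2m+2}=-\frac{m+1}{2m(2^{2m+2}-1)}\sum_{h=1}^{m}\frac{(2^{2h}-1)B_{2h}}{h}\binom{2m+1}{2h-2}. \]
   Context: $B_s$ is the $s$th Bernoulli number (e.g. $B_2=1/6$, $B_4=-1/30$). *)

(* Defs.v *)
From mathcomp Require Import all_boot all_order all_algebra ring.

Set Implicit Arguments.
Unset Strict Implicit.
Unset Printing Implicit Defensive.

Import Order.TTheory GRing.Theory Num.Theory.
Local Open Scope ring_scope.

(* [bernoulli_seq n] is [:: B_0; ...; B_(n-1)], built from the recurrence
     B_n = [n = 0] - 1 / (n + 1) * \sum_(k < n) 'C(n + 1, k) * B_k,
   i.e. B_n / n! is the coefficient of t^n in t / (e^t - 1); in particular
   the convention is B_1 = - 1/2. *)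
Fixpoint bernoulli_seq (n : nat) : seq rat :=
  if n is n'.+1 then
    let s := bernoulli_seq n' in
    rcons s ((n' == 0%N)%:R
             - n'.+1%:R^-1 * \sum_(k < n') 'C(n'.+1, k)%:R * s`_k)
  else [::].

Definition bernoulli (n : nat) : rat := (bernoulli_seq n.+1)`_n.

Lemma size_bernoulli_seq n : size (bernoulli_seq n) = n.
Proof. by elim: n => //= n IHn; rewrite size_rcons IHn. Qed.

Lemma nth_bernoulli_seq n k : (k < n)%N -> (bernoulli_seq n)`_k = bernoulli k.
Proof.
elim: n => // n IHn; rewrite ltnS leq_eqVlt => /orP[/eqP -> //|lt_kn].
by rewrite /= nth_rcons size_bernoulli_seq lt_kn IHn.
Qed.

Lemma bernoulliE n :
  bernoulli n =
    (n == 0%N)%:R - n.+1%:R^-1 * \sum_(k < n) 'C(n.+1, k)%:R * bernoulli k.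
Proof.
rewrite {1}/bernoulli /= nth_rcons size_bernoulli_seq ltnn eqxx.
by under eq_bigr => k _ do rewrite nth_bernoulli_seq //.
Qed.

Lemma bernoulli_rec n :
  \sum_(k < n.+1) 'C(n.+1, k)%:R * bernoulli k = (n == 0%N)%:R.
Proof.
rewrite big_ord_recr /= [bernoulli n]bernoulliE binSn mulrBr mulVKf ?pnatr_eq0 //.
by rewrite addrC subrK; case: n => [|n]; rewrite ?mul1r ?mulr0.
Qed.

(* Coefficientwise form of
     (\sum_k B_k t^k / k!) * ((e^t - 1) / t) = 1. *)
Lemma bernoulli_egf n :
  \sum_(k < n.+1) (bernoulli k / k`!%:R) * ((n - k).+1)`!%:R^-1
    = (n == 0%N)%:R.
Proof.
have fn0 j : j`!%:R != 0 :> rat by rewrite pnatr_eq0 -lt0n fact_gt0.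
apply: (mulfI (fn0 n.+1)); rewrite mulr_sumr.
transitivity (\sum_(k < n.+1) 'C(n.+1, k)%:R * bernoulli k).
  apply: eq_bigr => k _.
  have le_kn : (k <= n)%N by rewrite -ltnS.
  have := fn0 k; have := fn0 (n - k).+1.
  rewrite -(bin_fact (leqW le_kn)) subSn // natrM [(k`! * _)%:R]natrM.
  move: (k`!%:R) ((n - k).+1`!%:R) ('C(_, _)%:R) => a b c b0 a0.
  by field; rewrite b0.
by rewrite bernoulli_rec; case: n => [|n]; rewrite ?mulr1 ?mulr0.
Qed.

(* Main.v *)
Require Import Defs.
From HB Require Import structures.
From mathcomp Require Import all_boot all_order all_algebra.
From mathcomp Require Import ring zify.

(** Let [L] be the umbral functional on polynomials, [L ('X^n) = B_n]; up to
    scaling it is the only linear functional with [L (p(X+1) - p(X)) = p'(0)].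
    Both [p |-> L (p(-X-1))] and [p |-> L (p(2X+1)) + L (p(2X))] have this
    property up to a scalar, so [L (p(-X-1)) = L p], which kills the odd
    Bernoulli numbers, and [L (p(2X+1)) + L (p(2X)) = 2 L p].  With
    [c_k = (2^(k+1) - 1) B_(k+1) / (k+1)] the latter, at [p = 'X^(n+1)], reads
    [\sum_k 'C(n, k) c_k = - c_n] for [n > 0].  Subtracting consecutive
    instances gives [\sum_k 'C(n, k) c_(k+1) = c_n - c_(n+1)], and for
    [n = 2m+1] all the terms with [k] odd, as well as [c_(n+1)], vanish;
    the term [k = 2m] is [(2m+1) c_(2m+1)], a multiple of [B_(2m+2)]. *)

Import GRing.Theory Num.Theory.
Local Open Scope ring_scope.

Definition umbral (p : {poly rat}) : rat^o :=
  \sum_(i < size p) p`_i * bernoulli i.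

Lemma umbral_widen n (p : {poly rat}) :
  (size p <= n)%N -> umbral p = \sum_(i < n) p`_i * bernoulli i.
Proof.
move=> le_pn.
rewrite /umbral (big_ord_widen n (fun i => p`_i * bernoulli i)) //.
rewrite big_mkcond; apply: eq_bigr => i _; case: ltnP => // le_pi.
by rewrite nth_default ?mul0r.
Qed.

Lemma umbral_linear : linear umbral.
Proof.
move=> a p q; set n := maxn (size p) (size q).
rewrite (@umbral_widen n p) ?leq_maxl // (@umbral_widen n q) ?leq_maxr //.
rewrite (@umbral_widen n); last first.
  rewrite (leq_trans (size_polyD _ _)) // geq_max leq_maxr andbT.
  by rewrite (leq_trans (size_scale_leq _ _)) ?leq_maxl.
rewrite scaler_sumr -big_split; apply: eq_bigr => i _ /=.
by rewrite coefD coefZ mulrDl -mulrA.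
Qed.

HB.instance Definition _ :=
  GRing.isLinear.Build rat {poly rat} rat^o _ umbral umbral_linear.

Lemma umbralXn n : umbral 'X^n = bernoulli n.
Proof.
rewrite (@umbral_widen n.+1) ?size_polyXn // big_ord_recr /= coefXn eqxx mul1r.
rewrite big1 ?add0r // => i _.
by rewrite coefXn ltn_eqF ?mul0r.
Qed.

Lemma linear_poly_ext (f g : {linear {poly rat} -> rat^o}) :
  (forall n, f 'X^n = g 'X^n) -> f =1 g.
Proof.
move=> fg p; rewrite -[p]coefK poly_def !linear_sum.
by apply: eq_bigr => i _; rewrite !linearZ fg.
Qed.

Lemma umbral_affineXn (a : rat) n :
  umbral ((a *: 'X + 1) ^+ n)
    = \sum_(k < n.+1) 'C(n, k)%:R * (a ^+ k * bernoulli k).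
Proof.
rewrite addrC exprDn linear_sum; apply: eq_bigr => k _.
rewrite expr1n mul1r exprZn -scaler_nat scalerA linearZ /= umbralXn.
by rewrite -[_ *: _]/(_ * _) mulrA.
Qed.

(** The terms of the binomial expansion below ['X^n] add up to the left side of [bernoulli_rec],
    whence the correction at [n = 1]. *)
Lemma umbral_XaddC1n n :
  umbral (('X + 1) ^+ n) = bernoulli n + (n == 1%N)%:R.
Proof.
rewrite -[X in X + 1]scale1r umbral_affineXn.
under eq_bigr => k _ do rewrite expr1n mul1r.
rewrite big_ord_recr /= binn mul1r addrC; congr (_ + _).
by case: n => [|n]; rewrite ?big_ord0 // bernoulli_rec.
Qed.

Lemma umbral_shift p : umbral (p \Po ('X + 1)) = umbral p + p^`().[0].
Proof.
suff: umbral \o comp_poly ('X + 1) =1 umbral \+ (horner_eval 0 \o deriv).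
  by apply.
apply: linear_poly_ext => n /=.
rewrite /horner_eval comp_Xn_poly umbral_XaddC1n umbralXn derivXn.
by rewrite hornerMn hornerXn expr0n; case: n => [|[|n]] /=; rewrite ?mul0rn.
Qed.

(** Strong induction: [('X + 1) ^+ n.+1 - 'X^n.+1] has leading term [n.+1 *: 'X^n], so the
    hypothesis at [n.+1] determines [M 'X^n] from lower powers, by the recurrence that defines the
    Bernoulli numbers. *)
Lemma umbral_unique (M : {linear {poly rat} -> rat^o}) (c : rat) :
  (forall n, M (('X + 1) ^+ n - 'X^n) = c * (n == 1%N)%:R) ->
  forall p, M p = c * umbral p.
Proof.
move=> hM; suff: M =1 c \*: umbral by [].
apply: linear_poly_ext => /=; elim/ltn_ind => n IHn; rewrite umbralXn.
have := hM n.+1; rewrite exprD1n big_ord_recr /= binn mulr1n addrK.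
under eq_bigr => k _ do rewrite -scaler_nat.
rewrite linear_sum eqSS -bernoulli_rec mulr_sumr !big_ord_recr /=.
rewrite (eq_bigr (fun k : 'I_n => c * ('C(n.+1, k)%:R * bernoulli k))).
  rewrite linearZ /= => /addrI; rewrite mulrCA; apply: mulfI.
  by rewrite binSn pnatr_eq0.
by move=> k _; rewrite linearZ /= IHn // umbralXn mulrCA.
Qed.

(** With q(X) = p(-X), the substitution turns p(X+1) - p(X) into q(X) - q(X+1), on which [umbral] is
    -q'(0) = p'(0); hence the scalar 1. *)
Lemma umbral_reflect p : umbral (p \Po (- 'X - 1)) = umbral p.
Proof.
rewrite -[RHS]mul1r.
apply: (@umbral_unique (umbral \o comp_poly (- 'X - 1)) 1) => n /=.
have -> : (('X + 1) ^+ n - 'X^n) \Po (- 'X - 1)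
          = (- 'X) ^+ n - ((- 'X) ^+ n \Po ('X + 1)) :> {poly rat}.
  rewrite comp_polyB !rmorphXn /= comp_polyD.
  rewrite [- _ \Po _]raddfN /= !comp_polyX comp_polyC.
  by congr (_ ^+ n - _ ^+ n); ring.
rewrite linearB /= umbral_shift deriv_exp derivN derivX.
rewrite hornerMn hornerM horner_exp !hornerN hornerX hornerC oppr0 expr0n.
by case: n => [|[|n]] /=; rewrite ?mulr0n ?mulr1n; ring.
Qed.

(** With q(X) = p(2X), the two images of p(X+1) - p(X) telescope to q(X+1) - q(X), on which [umbral]
    is q'(0) = 2p'(0); hence the scalar 2. *)
Lemma umbral_double p :
  umbral (p \Po (2 *: 'X + 1)) + umbral (p \Po (2 *: 'X)) = 2 * umbral p.
Proof.
apply: (@umbral_unique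
  ((umbral \o comp_poly (2 *: 'X + 1)) \+ (umbral \o comp_poly (2 *: 'X))) 2).
move=> n /=.
rewrite -linearD /=.
have -> : (('X + 1) ^+ n - 'X^n) \Po (2 *: 'X + 1)
          + ((('X + 1) ^+ n - 'X^n) \Po (2 *: 'X))
          = ((2 *: 'X) ^+ n \Po ('X + 1)) - (2 *: 'X) ^+ n :> {poly rat}.
  rewrite !comp_polyB !rmorphXn /= !comp_polyD !comp_polyX !comp_polyC.
  rewrite comp_polyZ comp_polyX polyC1 addrA subrK.
  by congr (_ ^+ n - _ ^+ n); rewrite -!mul_polyC; ring.
rewrite linearB /= umbral_shift deriv_exp derivZ derivX addrAC subrr add0r.
rewrite hornerMn hornerM horner_exp !hornerZ hornerX hornerC mulr0 expr0n.
by case: n => [|[|n]] /=; rewrite ?mulr0n ?mulr1n; ring.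
Qed.

Lemma bernoulli_odd n : odd n -> (1 < n)%N -> bernoulli n = 0.
Proof.
move=> odd_n lt1n; have := umbral_reflect 'X^n.
rewrite comp_Xn_poly -opprD exprNn -signr_odd odd_n expr1 mulN1r linearN /=.
rewrite umbral_XaddC1n umbralXn gtn_eqF // addr0 => /eqP.
by rewrite eq_sym -addr_eq0 -mulr2n mulrn_eq0 => /eqP.
Qed.

Lemma bernoulli_double n :
  \sum_(k < n.+1) 'C(n, k)%:R * (2 ^+ k * bernoulli k)
    = (2 - 2 ^+ n) * bernoulli n.
Proof.
have := umbral_double 'X^n; rewrite !comp_Xn_poly umbral_affineXn exprZn.
rewrite linearZ /= umbralXn => /(canRL (addrK _)) ->.
by rewrite mulrBl.
Qed.

(* [- 1 / (e^t + 1) = \sum_k logistic_coef k * t^k / k`!]. *)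
Definition logistic_coef (k : nat) : rat :=
  (2 ^+ k.+1 - 1) * bernoulli k.+1 / k.+1%:R.

Lemma logistic_coef_even k : ~~ odd k -> (0 < k)%N -> logistic_coef k = 0.
Proof.
by move=> even_k k_gt0; rewrite /logistic_coef bernoulli_odd //= mulr0 mul0r.
Qed.

Lemma logistic_coef_rec n :
  (0 < n)%N ->
  \sum_(k < n.+1) 'C(n, k)%:R * logistic_coef k = - logistic_coef n.
Proof.
move=> n_gt0; have n1_neq0 : n.+1%:R != 0 :> rat by rewrite pnatr_eq0.
apply: (mulfI n1_neq0); rewrite /logistic_coef mulrN mulrC.
transitivity
  (\sum_(j < n.+2) 'C(n.+1, j)%:R * ((2 ^+ j - 1) * bernoulli j)).
  (* The term [j = 0] vanishes because [2 ^+ 0 - 1 = 0]. The others match by absorption,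
     [n.+1 * 'C(n, k) = k.+1 * 'C(n.+1, k.+1)], which cancels the denominator of
     [logistic_coef k]. *)
  rewrite [RHS]big_ord_recl /= expr0 subrr mul0r mulr0 add0r mulr_suml.
  apply: eq_bigr => k _; rewrite /bump /= add1n.
  have := mul_bin_diag n.+1 k => /(congr1 (fun i : nat => i%:R : rat)).
  rewrite !natrM /= => e.
  have k1_neq0 : k.+1%:R != 0 :> rat by rewrite pnatr_eq0.
  rewrite -(mulKf k1_neq0 'C(n.+1, k.+1)%:R) -e.
  move: ('C(n, k)%:R : rat) (bernoulli k.+1) (2 ^+ k.+1 : rat) => x y z.
  by move: k.+1%:R k1_neq0 {e} => w w_neq0; field.
under eq_bigr => j _ do rewrite mulrBl mul1r mulrBr.
rewrite sumrB bernoulli_double big_ord_recr /= bernoulli_rec binn mul1r.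
rewrite [n == 0%N]gtn_eqF //.
by move: (n.+1%:R : rat) n1_neq0 => w w_neq0 /=; field.
Qed.

Lemma logistic_coef_shift_rec n :
  (0 < n)%N ->
  \sum_(k < n.+1) 'C(n, k)%:R * logistic_coef k.+1
    = logistic_coef n - logistic_coef n.+1.
Proof.
move=> n_gt0; have := @logistic_coef_rec n.+1 isT.
have := @logistic_coef_rec n n_gt0.
rewrite [in X in _ -> X -> _]big_ord_recl /= bin0.
(* The shifted sum may run up to [k = n] since ['C(n, n.+1) = 0]; its range then agrees with that of
   the instance at [n.+1], which Pascal's rule splits. *)
have -> : \sum_(k < n.+1) 'C(n, k)%:R * logistic_coef k
    = logistic_coef 0 + \sum_(k < n.+1) 'C(n, k.+1)%:R * logistic_coef k.+1.
  rewrite big_ord_recl bin0 mul1r [in RHS]big_ord_recr /= bin_small //.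
  by rewrite mul0r addr0.
under [in X in _ -> X -> _]eq_bigr => k _ do
  rewrite /bump /= add1n binS natrD mulrDl.
rewrite big_split /= mul1r addrA => -> /(canRL (addKr _)) ->.
by rewrite opprK.
Qed.

Lemma sum_double (V : nmodType) (F : nat -> V) n :
  (forall k, odd k -> F k = 0) ->
  \sum_(k < n.*2) F k = \sum_(h < n) F h.*2.
Proof.
move=> F0; elim: n => [|n IHn]; first by rewrite !big_ord0.
rewrite doubleS !big_ord_recr /= IHn [F n.*2.+1]F0 ?addr0 //=.
by rewrite odd_double.
Qed.

Theorem corollary2p8 (m : nat) (hm : (0 < m)%N) :
  bernoulli (2 * m + 2) =
    - ((m%:R + 1) / (2 * m%:R * (2 ^+ (2 * m + 2) - 1)))
    * \sum_(1 <= h < m.+1)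
        ((2 ^+ (2 * h) - 1) * bernoulli (2 * h) / h%:R)
        * 'C(2 * m + 1, 2 * h - 2)%:R.
Proof.
have := @logistic_coef_shift_rec m.*2.+1 isT; rewrite -doubleS.
rewrite (@sum_double _ (fun k => 'C(m.*2.+1, k)%:R * logistic_coef k.+1));
  last first.
  by move=> k odd_k; rewrite logistic_coef_even ?mulr0 //= odd_k.
rewrite [logistic_coef m.+1.*2]logistic_coef_even ?odd_double // subr0.
(* The top term, [h = m], is the one that contains [bernoulli (2 * m + 2)]. *)
rewrite big_ord_recr /= binSn.
set S := \sum_(1 <= h < _) _.
(* The factor 1/2 arises because [logistic_coef] divides by 2h where the summand of [S] divides by
   h. *)
have -> : \sum_(h < m) 'C(m.*2.+1, h.*2)%:R * logistic_coef h.*2.+1 = S / 2.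
  rewrite /S big_add1 /= big_mkord mulr_suml; apply: eq_bigr => h _.
  rewrite /logistic_coef.
  have -> : (2 * h.+1 - 2 = h.*2)%N by lia.
  have -> : (2 * h.+1 = h.*2.+2)%N by lia.
  have -> : (2 * m + 1 = m.*2.+1)%N by lia.
  have -> : h.*2.+2%:R = 2 * h.+1%:R :> rat by rewrite -doubleS -mul2n natrM.
  have : h.+1%:R != 0 :> rat by rewrite pnatr_eq0.
  by move: (h.+1%:R : rat) => w w_neq0; field.
rewrite /logistic_coef.
have -> : (2 * m + 2 = m.*2.+2)%N by lia.
have -> : m.*2.+2%:R = 2 * (m%:R + 1) :> rat.
  by rewrite -doubleS -mul2n natrM natr1.
have -> : m.*2.+1%:R = 2 * m%:R + 1 :> rat by rewrite -natr1 -mul2n natrM.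
have pow_neq0 : 2 ^+ m.*2.+2 - 1 != 0 :> rat.
  by rewrite subr_eq0 -(natrX rat 2) pnatr_eq1 -(expn0 2) eqn_exp2l.
have m_neq0 : m%:R != 0 :> rat by rewrite pnatr_eq0 -lt0n.
have m1_neq0 : m%:R + 1 != 0 :> rat by rewrite natr1 pnatr_eq0.
move: (2 ^+ _ - 1) pow_neq0 => q q_neq0 e.
(* [e] reads S/2 + (2m+1)c = c with c = [logistic_coef m.*2.+1] unfolded, so S/2 = -2mc. *)
have -> : S = 2 * (S / 2) by field.
rewrite (canRL (addrK _) e).
by field; rewrite q_neq0 m_neq0 m1_neq0.
Qed.
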